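(* For every positive integer $r$ and all real constants $\varepsilon,\gamma,C>0$, there are a positive integer $n_0=n_0(r,\varepsilon,\gamma,C)$ and a constant $K=K(r,\varepsilon,\gamma,C)>0$ such that the following holds for every integer $n\geq n_0$. Let $I_1,\dots,I_r\subseteq \mathbb{Z}$ be finite intervals such that $|I_j|\geq\varepsilon n$ for all $1\leq j\leq r$ and $$\gamma n^{r+1}\le |I_1|\cdots |I_r|\le \varepsilon^{-1}n^{r+1}.$$ Let $t_1,\dots,t_r$ be nonzero reals, and define $\pi:\mathbb Z^r\to\mathbb{R}$ by $\pi(x_1,\dots,x_r):=t_1x_1+\cdots+t_rx_r$. Suppose $X\subseteq I_1\times\cdots\times I_r$ satisfies $|X|\ge \gamma n^{r+1}$ and $|\pi(X)|\le Cn^2$. Then there is a positive real number $a$ such that $t_1,\dots,t_r\in a\cdot \mathbb{Z}$ and $$|a^{-1}t_j|\cdot|I_j|\leq K n^2 \quad \text{for all }1\le j\le r.$$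
   Context: A finite interval in $\mathbb{Z}$ is a set of consecutive integers $\{p,p+1,\ldots,q\}$, and $|I|$ denotes its cardinality. $a\cdot\mathbb{Z}:=\{ak:k\in\mathbb{Z}\}$. *)

(* Defs.v *)
From mathcomp Require Import all_boot all_order all_algebra finmap.
From mathcomp Require Import classical_sets reals.

Set Implicit Arguments.
Unset Strict Implicit.
Unset Printing Implicit Defensive.

Import Order.TTheory GRing.Theory Num.Theory.
Local Open Scope ring_scope.

(* {p, p+1, ..., q}; it is empty when q < p. *)
Definition finite_interval (I : {fset int}) : Prop :=
  exists p q : int, forall k : int, (k \in I) = (p <= k <= q).

(* Integer points of Z^r are finite functions 'I_r -> int. *)
Definition in_box (r : nat) (I : 'I_r -> {fset int}) (x : {ffun 'I_r -> int})
  : Prop := forall j : 'I_r, x j \in I j.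

Definition linear_form (R : realType) (r : nat) (t : 'I_r -> R)
  (x : {ffun 'I_r -> int}) : R := \sum_(j < r) t j * (x j)%:~R.

Definition int_multiples (R : realType) (a : R) : set R :=
  [set a * k%:~R | k in [set: int]]%classic.

(* Main.v *)
Require Import Defs.
From mathcomp Require Import all_boot all_order all_algebra finmap.
From mathcomp Require Import classical_sets reals zify ring lra.

Set Implicit Arguments.
Unset Strict Implicit.
Unset Printing Implicit Defensive.

Import Order.TTheory GRing.Theory Num.Theory.
Local Open Scope ring_scope.

(** Write pi for the linear form, L_j for the side |I_j| and B for the whole box
    I_1 x ... x I_r.

    The set X matters only through a bound on the image of the whole box.  The
    map (x, y) |-> (pi x, x + y), with y running over representatives of the
    values of pi on B, is injective on X x pi(B), since pi y = pi (x + y) - pi x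
    recovers y.  Hence |X| |pi(B)| <= |pi(X)| |B + B| <= |pi(X)| 2^r |B|, and the
    size hypotheses give |pi(B)| <= D n^2 with D depending only on r, eps, gamma
    and C ([card_box_image_le]).

    Now pi(B) is a translate of a sum of r arithmetic progressions of steps t_j
    and lengths L_j.  The lower bound on the product of the L_j forces some side
    L_j0 to exceed any fixed multiple of n when n is large
    ([exists_long_side]); since every L_j is at least eps n, the product
    L_j0 L_j then exceeds any fixed multiple of n^2, hence of |pi(B)|.

    Start with the progression of step |t_j0| and length L_j0, and absorb the
    other directions one at a time.  If the current progression has step a and
    length M, and M L_j > 4 |pi(B)|, then the sums a i + t_j l with i < M / 2
    and l < L_j / 2 cannot be distinct; a collision gives t_j q = a p with p, q
    coprime and small compared with M and L_j.  The numerical semigroup generated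
    by p and q has no gaps beyond p q, so the sum of the two progressions contains
    a progression of step b = a / q whose length M' is at least
    max (q M, |p| L_j) / 2 ([merge_progressions]).  As a = q b and t_j = p b,
    all directions absorbed so far are integer multiples k_i b with
    |k_i| L_i <= 2^(number of steps) M', which keeps the induction going: applied
    to j0 it shows that M' is still comparable to L_j0
    ([long_progression_in_box_image]).

    After all directions are absorbed, the progression lies in pi(B), so its
    length is at most D n^2, and |k_j| L_j <= 2^r D n^2. *)

(** * Sumsets and fibres of an additive map *)

(** The map (x, u) |-> (f x, x + g u), with g u in B a representative of the
    value u, is injective: f (g u) = u is the difference of f (x + g u)
    and f x. *)
Lemma card_image_mul_sumset (U V : zmodType) (f : V -> U) (A B : {fset V}) :
  {morph f : x y / x + y} ->
  (#|` A| * #|` [fset f y | y in B]%fset|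
    <= #|` [fset f x | x in A]%fset|
       * #|` [fset (x + y)%R | x in A, y in B]%fset|)%N.
Proof.
move=> fD; set fA := [fset f x | x in A]%fset; set fB := [fset f y | y in B]%fset.
set S := [fset (x + y)%R | x in A, y in B]%fset.
have repr_ex (u : fB) : exists y, (y \in B) && (f y == val u).
  by case/imfsetP: (valP u) => /= y yB ->; exists y; rewrite yB eqxx.
pose g (u : fB) := xchoose (repr_ex u).
have gB u : g u \in B by case/andP: (xchooseP (repr_ex u)).
have fg u : f (g u) = val u by case/andP: (xchooseP (repr_ex u)) => _ /eqP.
have inA (x : A) : f (val x) \in fA by apply/in_imfset/valP.
have inS (x : A) (u : fB) : val x + g u \in S.
  by apply/in_imfset2; [apply: valP | apply: gB].
rewrite !cardfE -!card_prod.
apply: (@leq_card _ _ (fun z : A * fB => ([` inA z.1], [` inS z.1 z.2])%fset)).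
move=> [x u] [x' u'] /= [fxx' sxx'].
have uu' : u = u'.
  by apply/val_inj/(addrI (f (val x))); rewrite -!fg {2}fxx' -!fD sxx'.
by rewrite uu' in sxx' *; congr (_, _); apply/val_inj/(addIr (g u')).
Qed.

(** * Boxes of integer points *)

Definition box_point (r : nat) (p : 'I_r -> int) (L : 'I_r -> nat)
    (z : {dffun forall j : 'I_r, 'I_(L j)}) : {ffun 'I_r -> int} :=
  [ffun j => p j + (z j : nat)%:Z].

Definition int_box (r : nat) (p : 'I_r -> int) (L : 'I_r -> nat) :
    {fset {ffun 'I_r -> int}} :=
  [fset box_point p z | z in {dffun forall j : 'I_r, 'I_(L j)}]%fset.

Lemma in_int_box (r : nat) (p : 'I_r -> int) (L : 'I_r -> nat)
    (x : {ffun 'I_r -> int}) :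
  reflect (forall j, p j <= x j < p j + (L j)%:Z) (x \in int_box p L).
Proof.
apply: (iffP (imfsetP _ _ _ _)) => [[z _ ->] j|xbox].
  by rewrite ffunE; have := ltn_ord (z j); rewrite lerDl ltrD2l ltz_nat => ->.
have zlt j : (`|x j - p j| < L j)%N by have := xbox j; lia.
exists (finfun (fun j => Ordinal (zlt j)) : {dffun forall j : 'I_r, 'I_(L j)}) => //.
by apply/ffunP => j; rewrite !ffunE /=; have := xbox j; lia.
Qed.

Lemma card_int_box (r : nat) (p : 'I_r -> int) (L : 'I_r -> nat) :
  (#|` int_box p L| <= \prod_(j < r) L j)%N.
Proof.
apply: leq_trans (leq_imfset_card _ _ _) _ => /=.
rewrite -cardE card_dep_ffun foldrE big_map -big_enum /= leq_eqVlt.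
by apply/orP; left; apply/eqP; rewrite !big_enum; apply: eq_bigr => j _; rewrite card_ord.
Qed.

(** An interval with no elements has to be treated apart: there q - p + 1 is not
    the cardinality. *)
Lemma finite_intervalE (I : {fset int}) : finite_interval I ->
  exists p : int, forall k, (k \in I) = (p <= k < p + #|` I|%:Z).
Proof.
move=> [p [q Ipq]]; exists p.
case: (ltP q p) => [qp | pq].
  have -> : I = fset0 by apply/fsetP => k; rewrite Ipq inE; lia.
  by move=> k; rewrite cardfs0 inE; lia.
suff -> : #|` I| = `|q - p|.+1 by move=> k; rewrite Ipq; lia.
pose e (i : 'I_(`|q - p|.+1)) := p + (i : nat)%:Z.
have -> : I = [fset e i | i : 'I_(`|q - p|.+1)]%fset.
  apply/fsetP => k; apply/idP/imfsetP => [|[i _ ->]]; rewrite Ipq.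
    move=> kpq; have kl : (`|k - p| < `|q - p|.+1)%N by lia.
    by exists (Ordinal kl) => //; rewrite /e /=; lia.
  by have := ltn_ord i; rewrite /e; lia.
rewrite card_imfset /= -?cardE ?card_ord // => i i' ii'; apply/val_inj => /=.
by move: ii'; rewrite /e; lia.
Qed.

(** * Merging two arithmetic progressions *)

(** The coefficient l is determined modulo q by p l = m [mod q]; choosing it in
    [0, q) leaves a multiple of q, which is nonnegative because m >= p q. *)
Lemma coprime_representable (p q m : nat) : coprime p q -> (0 < q)%N ->
  (p * q <= m)%N -> exists i l : nat, (l < q)%N /\ m = (q * i + p * l)%N.
Proof.
move=> cpq q_gt0 pqm.
have [l lq ql] : exists2 l, (l < q)%N & p * l = m %[mod q].
  (* The Chinese remainder solution is p l with l prescribed modulo q. *)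
  exists ((chinese p q 0 m %/ p) %% q)%N; rewrite ?ltn_mod //.
  have pd : (p %| chinese p q 0 m)%N by rewrite /dvdn chinese_modl // mod0n.
  by rewrite modnMmr mulnC divnK // chinese_modr.
have plm : (p * l <= m)%N by apply: leq_trans pqm; rewrite leq_mul2l (ltnW lq) orbT.
exists ((m - p * l) %/ q)%N, l; split => //.
by rewrite mulnC divnK ?subnK // -eqn_mod_dvd //; apply/eqP.
Qed.

Lemma coprime_semigroup_run (p q M L m : nat) : coprime p q ->
  (0 < q)%N -> (q <= L)%N -> (p * q <= m < q * M)%N ->
  exists i l : nat, [/\ (i < M)%N, (l < L)%N & m = (q * i + p * l)%N].
Proof.
move=> cpq q0 qL /andP[pqm mqM].
have [i [l [lq mE]]] := coprime_representable cpq q0 pqm.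
exists i, l; split => //; last exact: leq_trans qL.
by rewrite -(ltn_pmul2l q0); apply: leq_ltn_trans mqM; rewrite mE leq_addr.
Qed.

(** The quarter of the grid with i < M / 2 and l < L / 2 already has more points
    than P, so two of them have the same image.  Restricting to it makes the
    differences p and q at most half of M and L, and dividing by the gcd only
    shrinks them; this room is what keeps the merged progression long. *)
Lemma commensurable_of_small_sumset (R : realType) (u a t : R) (M L : nat)
    (P : {fset R}) : 0 < a -> 0 < t -> (4 * #|` P| < M * L)%N ->
  (forall i l, (i < M)%N -> (l < L)%N -> u + a * i%:R + t * l%:R \in P) ->
  exists p q : nat, [/\ [&& 0 < p, 2 * p <= M, 0 < q & 2 * q <= L]%N,
    coprime p q & t * q%:R = a * p%:R].
Proof.
move=> a0 t0 PML inP.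
have iM (i : 'I_(uphalf M)) : (i < M)%N by have := ltn_ord i; lia.
have lL (l : 'I_(uphalf L)) : (l < L)%N by have := ltn_ord l; lia.
pose v (z : 'I_(uphalf M) * 'I_(uphalf L)) : P :=
  [` inP _ _ (iM z.1) (lL z.2)]%fset.
have : ~~ injectiveb v.
  apply/negP => /injectiveP /leq_card; rewrite card_prod !card_ord -cardfE.
  have := leq_mul (leqnn M) (leqnn L); nia.
case/injectivePn => -[i l] [[i' l'] neq /(congr1 val) /= eqv].
have {}eqv : t * l%:R - t * l'%:R = a * i'%:R - a * i%:R by lra.
wlog ll' : i l i' l' neq eqv / (l' < l)%N.
  case: (ltngtP l l') => [ll'|l'l|/val_inj ll'] W.
  - by apply: (W i' l' i l); rewrite // 1?eq_sym //; lra.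
  - exact: (W i l i' l').
  - case/negP: neq; rewrite ll' in eqv *; apply/eqP; congr (_, _).
    apply/val_inj/eqP; rewrite -(eqr_nat R); apply/eqP/(mulfI (lt0r_neq0 a0)).
    by lra.
have ii' : (i < i')%N.
  rewrite -(ltr_nat R) -(ltr_pM2l a0).
  have : t * l'%:R < t * l%:R by rewrite ltr_pM2l // ltr_nat.
  by lra.
pose d := gcdn (i' - i) (l - l').
have d0 : (0 < d)%N by rewrite gcdn_gt0; lia.
have dp : (d * ((i' - i) %/ d) = i' - i)%N by rewrite mulnC divnK ?dvdn_gcdl.
have dq : (d * ((l - l') %/ d) = l - l')%N by rewrite mulnC divnK ?dvdn_gcdr.
exists ((i' - i) %/ d)%N, ((l - l') %/ d)%N; split.
- have := ltn_ord i'; have := ltn_ord l; move: dp dq; set p := (_ %/ d)%N; set q := (_ %/ d)%N.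
  by nia.
- rewrite /coprime -(eqn_pmul2l d0) muln_gcdr dp dq muln1 //.
- apply: (mulfI (_ : d%:R != 0 :> R)); first by rewrite pnatr_eq0 -lt0n.
  rewrite mulrCA -natrM dq [RHS]mulrCA -natrM dp !natrB ?(ltnW ii') ?(ltnW ll') //.
  lra.
Qed.

(** With b = a / q we have a i + t l = b (q i + p l), so that the problem becomes
    which integers q i + p l represents.  It represents all those in
    [p q, q M) using l < q, and all those in [p q, p L) using i < p; since
    2 p <= M and 2 q <= L, the longer of these two runs has length at least half
    of the maximum of q M and p L. *)
Lemma merge_progressions_pos (R : realType) (u a t : R) (M L : nat)
    (P : {fset R}) : 0 < a -> 0 < t -> (4 * #|` P| < M * L)%N ->
  (forall i l, (i < M)%N -> (l < L)%N -> u + a * i%:R + t * l%:R \in P) ->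
  exists (u' b : R) (p q M' : nat), [/\ 0 < b, a = b * q%:R, t = b * p%:R,
    (q * M <= 2 * M')%N /\ (p * L <= 2 * M')%N
    & forall m, (m < M')%N -> exists i l : nat,
      [/\ (i < M)%N, (l < L)%N & u' + b * m%:R = u + a * i%:R + t * l%:R]].
Proof.
move=> a0 t0 PML inP.
have [p [q [/and4P[p0 pM q0 qL] cpq tq]]] := commensurable_of_small_sumset a0 t0 PML inP.
have qR0 : q%:R != 0 :> R by rewrite pnatr_eq0 -lt0n.
exists (u + a * p%:R), (a / q%:R), p, q, (maxn (q * M) (p * L) - p * q)%N; split.
- by rewrite divr_gt0 // ltr0n.
- by rewrite divfK.
- by rewrite mulrAC -tq mulfK.
- by split; nia.
have eval m i l : (m + p * q = q * i + p * l)%N ->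
    u + a * p%:R + a / q%:R * m%:R = u + a * i%:R + t * l%:R.
  move/(congr1 (fun k => k%:R : R)); rewrite !natrD !natrM => mE.
  have tE : t = a * p%:R / q%:R by rewrite -tq mulfK.
  have -> : m%:R = q%:R * i%:R + p%:R * l%:R - p%:R * q%:R :> R by rewrite -mE addrK.
  by rewrite tE; field.
move=> m mM.
case: (leqP (p * L) (q * M)) => pLqM.
  have qL' : (q <= L)%N by lia.
  have rng : (p * q <= m + p * q < q * M)%N by lia.
  have [i [l [iM lL mE]]] := coprime_semigroup_run cpq q0 qL' rng.
  by exists i, l; split => //; apply: eval.
have pM' : (p <= M)%N by lia.
have rng : (q * p <= m + p * q < p * L)%N by lia.
have cqp : coprime q p by rewrite coprime_sym.
have [l [i [lL iM mE]]] := coprime_semigroup_run cqp p0 pM' rng.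
by exists i, l; split => //; apply: eval; rewrite mE addnC.
Qed.

(** A negative step is reduced to a positive one by running through the second
    progression backwards. *)
Lemma merge_progressions (R : realType) (u a t : R) (M L : nat)
    (P : {fset R}) : 0 < a -> t != 0 -> (4 * #|` P| < M * L)%N ->
  (forall i l, (i < M)%N -> (l < L)%N -> u + a * i%:R + t * l%:R \in P) ->
  exists (u' b : R) (k : int) (q M' : nat), [/\ 0 < b, a = b * q%:R, t = b * k%:~R,
    (q * M <= 2 * M')%N /\ (`|k| * L <= 2 * M')%N
    & forall m, (m < M')%N -> exists i l : nat,
      [/\ (i < M)%N, (l < L)%N & u' + b * m%:R = u + a * i%:R + t * l%:R]].
Proof.
move=> a0; rewrite neq_lt => /orP[t0|t0] PML inP; last first.
  have [u' [b [p [q [M' [b0 aE tE M'E repr]]]]]] := merge_progressions_pos a0 t0 PML inP.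
  by exists u', b, p%:Z, q, M'; split; rewrite // ?pmulrn.
have nt0 : 0 < - t by rewrite oppr_gt0.
have refl (i l : nat) : (l < L)%N ->
    u + t * L.-1%:R + a * i%:R + - t * l%:R = u + a * i%:R + t * (L.-1 - l)%:R.
  by move=> lL; rewrite natrB; [ring | lia].
have [i l iM lL|u' [b [p [q [M' [b0 aE tE M'E repr]]]]]] :=
    @merge_progressions_pos R (u + t * L.-1%:R) a (- t) M L P a0 nt0 PML.
  by rewrite refl //; apply: inP => //; lia.
exists u', b, (- p%:Z), q, M'; split => //.
- by rewrite mulrNz mulrN -pmulrn -tE opprK.
- by rewrite abszN.
move=> m /repr [i [l [iM lL ->]]]; exists i, (L.-1 - l)%N; split; rewrite ?refl //; lia.
Qed.

(** * Absorbing the directions of a box one at a time *)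

Lemma linear_formD (R : realType) (r : nat) (t : 'I_r -> R) :
  {morph linear_form t : x y / x + y}.
Proof.
move=> x y; rewrite /linear_form -big_split /=; apply: eq_bigr => j _.
by rewrite ffunE intrD mulrDr.
Qed.

(** The sides of the face of a box in which only the coordinates in s move: the
    others are confined to a single value. *)
Definition partial_sides (r : nat) (L : 'I_r -> nat) (s : seq 'I_r) (j : 'I_r) :=
  if j \in s then L j else 1%N.

Local Notation box_image t p L := [fset linear_form t x | x in int_box p L]%fset.

Lemma box_imageS (R : realType) (r : nat) (t : 'I_r -> R) p L L' :
  (forall j, (L j <= L' j)%N) -> {subset box_image t p L <= box_image t p L'}.
Proof.
move=> LL' _ /imfsetP[x /in_int_box xL ->]; apply/in_imfset/in_int_box => j.
by have := xL j; have := LL' j; lia.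
Qed.

Lemma box_image_cons (R : realType) (r : nat) (t : 'I_r -> R) p L s j y (l : nat) :
  j \notin s -> (l < L j)%N -> y \in box_image t p (partial_sides L s) ->
  y + t j * l%:R \in box_image t p (partial_sides L (j :: s)).
Proof.
move=> js lL /imfsetP[x /in_int_box xL ->].
pose e := [ffun i => if i == j then l%:Z else 0] : {ffun 'I_r -> int}.
apply/imfsetP; exists (x + e) => /=.
  apply/in_int_box => i; have := xL i; rewrite !ffunE /partial_sides inE.
  by case: (eqVneq i j) => [->|_]; rewrite ?(negPf js) /=; lia.
rewrite linear_formD; congr (_ + _).
rewrite /linear_form (bigD1 j) //= ffunE eqxx big1 ?addr0 // => i ij.
by rewrite ffunE (negPf ij) mulr0.
Qed.

(** The factor 2 lost at each merging is why the bounds carry [2 ^ size s].  The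
    index j0 is absorbed first, and its own bound gives
    L j0 <= |k_j0| L j0 <= 2 ^ size s * M at every later stage; with the
    hypothesis on L j0 * L j this leaves M * L j > 4 |P|, P being the image of
    the whole box, so that the next merging is possible. *)
Lemma long_progression_in_box_image (R : realType) (r : nat) (t : 'I_r -> R)
    (p : 'I_r -> int) (L : 'I_r -> nat) (j0 : 'I_r) (s : seq 'I_r) :
  (forall j, t j != 0) ->
  (forall j, 2 ^ r.+2 * #|` box_image t p L| < L j0 * L j)%N ->
  uniq (rcons s j0) ->
  exists (u a : R) (M : nat), [/\ 0 < a,
    forall i, (i < M)%N ->
      u + a * i%:R \in box_image t p (partial_sides L (rcons s j0))
    & forall j, j \in rcons s j0 -> exists k : int,
      t j = a * k%:~R /\ (`|k| * L j <= 2 ^ size s * M)%N].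
Proof.
move=> t_neq0 bigL; have L_gt0 j : (0 < L j)%N by have := bigL j; nia.
elim: s => [_|j s IHs /= /andP[js us]].
  pose p' : {ffun 'I_r -> int} := [ffun j => p j].
  have inP l : (l < L j0)%N ->
      linear_form t p' + t j0 * l%:R \in box_image t p (partial_sides L [:: j0]).
    move=> lL; apply: box_image_cons => //; apply/in_imfset/in_int_box => j.
    by rewrite ffunE /partial_sides /=; lia.
  case: (ltP (t j0) 0) => [t_lt0|t_ge0].
    exists (linear_form t p' + t j0 * (L j0).-1%:R), (- t j0), (L j0); split.
    - by rewrite oppr_gt0.
    - move=> i iL; rewrite (_ : _ + _ = linear_form t p' + t j0 * ((L j0).-1 - i)%:R).
        by apply: inP; lia.
      by rewrite natrB; [ring | lia].
    - move=> j; rewrite inE => /eqP ->; exists (-1).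
      by rewrite mulrN1 opprK; split => //; lia.
  exists (linear_form t p'), (t j0), (L j0); split => //.
    by rewrite lt_def t_neq0.
  by move=> j; rewrite inE => /eqP ->; exists 1; rewrite mulr1; split => //; lia.
have [u [a [M [a0 inP kP]]]] := IHs us.
have M_big : (4 * #|` box_image t p L| < M * L j)%N.
  have [|k0 [tk0 kM]] := kP j0; first by rewrite mem_rcons mem_head.
  have k0_gt0 : (0 < `|k0|)%N.
    rewrite absz_gt0; apply: contraNneq (t_neq0 j0) => k00.
    by rewrite tk0 k00 mulr0.
  have sr : (size s <= r)%N.
    have := max_card (mem (rcons s j0)); rewrite card_ord (card_uniqP us) size_rcons.
    exact: ltnW.
  rewrite -(@ltn_pmul2l (2 ^ size s)) ?expn_gt0 //.
  apply: (@leq_ltn_trans (2 ^ r.+2 * #|` box_image t p L|)).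
    by have := leq_pexp2l (isT : 0 < 2)%N sr; rewrite !expnS; nia.
  apply: leq_trans (bigL j) _; rewrite mulnA leq_mul2r; apply/orP; right.
  by apply: leq_trans kM; rewrite leq_pmull.
have inP' i l : (i < M)%N -> (l < L j)%N ->
    u + a * i%:R + t j * l%:R \in box_image t p L.
  move=> /inP iP lL; apply: box_imageS (box_image_cons js lL iP) => i'.
  by rewrite /partial_sides; case: ifP.
have [u' [b [k [q [M' [b0 aE tE [qM kL] repr]]]]]] :=
  merge_progressions a0 (t_neq0 j) M_big inP'.
exists u', b, M'; split => // [m /repr [i [l [iM lL ->]]]|i].
  exact: box_image_cons (inP _ iM).
rewrite inE => /orP[/eqP ->|/kP[ki [tki kiM]]].
  exists k; split => //; apply: leq_trans kL _; rewrite expnS leq_mul2r.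
  by rewrite leq_pmulr ?orbT // expn_gt0.
exists (q%:Z * ki); split; first by rewrite tki aE intrM pmulrn mulrA.
rewrite abszM /= -mulnA expnSr -mulnA.
apply: (@leq_trans (q * (2 ^ size s * M))); first by rewrite leq_mul2l kiM orbT.
by rewrite mulnCA leq_mul2l qM orbT.
Qed.

(** * The theorem *)

(** If all sides were at most H n, their product would be at most H^r n^r, which
    is below gamma n^(r+1) for n large. *)
Lemma exists_long_side (R : realType) (r : nat) (gamma H : R) (n : nat)
    (L : 'I_r -> nat) : 0 <= H -> H ^+ r < gamma * n%:R ->
  gamma * n%:R ^+ r.+1 <= \prod_(j < r) (L j)%:R ->
  exists j, H * n%:R < (L j)%:R.
Proof.
move=> H0 Hn prodL; apply/existsP; apply: contraLR prodL.
rewrite negb_exists => /forallP short; rewrite -ltNge.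
case: (posnP n) => [n0|n_gt0].
  by rewrite n0 mulr0 ltNge exprn_ge0 in Hn.
have : \prod_(j < r) (L j)%:R <= \prod_(j < r) (H * n%:R).
  by apply: ler_prod => j _; rewrite ler0n leNgt short.
rewrite prodr_const card_ord exprMn => /le_lt_trans; apply.
by rewrite exprS mulrA ltr_pM2r // exprn_gt0 // ltr0n.
Qed.

(** The sumset of two copies of a box lies in a box with doubled sides, hence the
    factor [2 ^ r]. *)
Lemma card_box_image_le (R : realType) (r : nat) (t : 'I_r -> R)
    (p : 'I_r -> int) (L : 'I_r -> nat) (X : {fset {ffun 'I_r -> int}}) :
  (X `<=` int_box p L)%fset ->
  (#|` X| * #|` box_image t p L|
    <= #|` [fset linear_form t x | x in X]%fset| * (2 ^ r * \prod_(j < r) L j))%N.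
Proof.
move=> /fsubsetP XL.
apply: leq_trans (card_image_mul_sumset X _ (linear_formD t)) _.
rewrite leq_mul2l; apply/orP; right.
rewrite -[X in (2 ^ X * _)%N](card_ord r) -prod_nat_const -big_split /=.
apply: leq_trans (card_int_box (fun j => p j + p j) _).
apply/fsubset_leq_card/fsubsetP => _ /imfset2P[x xX [y yL ->]].
apply/in_int_box => j; rewrite ffunE.
have /in_int_box/(_ j)/andP[pxj xjL] := XL _ xX.
have /in_int_box/(_ j)/andP[pyj yjL] := yL.
by rewrite lerD //= mul2n -addnn PoszD addrACA ltrD.
Qed.

Theorem proposition4p4 (R : realType) (r : nat) (r_gt0 : (0 < r)%N)
    (eps gamma C : R) (eps_gt0 : 0 < eps) (gamma_gt0 : 0 < gamma)
    (C_gt0 : 0 < C) :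
  exists (n0 : nat) (K : R), (0 < n0)%N /\ 0 < K /\
    forall n : nat, (n0 <= n)%N ->
    forall I : 'I_r -> {fset int},
      (forall j : 'I_r, finite_interval (I j)) ->
      (forall j : 'I_r, eps * n%:R <= (#|` I j|)%:R) ->
      gamma * n%:R ^+ r.+1 <= \prod_(j < r) (#|` I j|)%:R ->
      \prod_(j < r) (#|` I j|)%:R <= eps^-1 * n%:R ^+ r.+1 ->
    forall t : 'I_r -> R, (forall j : 'I_r, t j != 0) ->
    forall X : {fset {ffun 'I_r -> int}},
      (forall x, x \in X -> in_box I x) ->
      gamma * n%:R ^+ r.+1 <= (#|` X|)%:R ->
      (#|` [fset linear_form t x | x in X]%fset|)%:R <= C * n%:R ^+ 2 ->
    exists a : R, 0 < a /\
      (forall j : 'I_r, int_multiples a (t j)) /\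
      (forall j : 'I_r, `|a^-1 * t j| * (#|` I j|)%:R <= K * n%:R ^+ 2).
Proof.
(* D n^2 bounds the image of the box. *)
pose D := C * 2 ^+ r / (gamma * eps).
have D_gt0 : 0 < D by rewrite divr_gt0 ?mulr_gt0 ?exprn_gt0.
(* A side longer than H n, multiplied by a side at least eps n, exceeds
   2^(r+2) D n^2. *)
pose H := 2 ^+ r.+2 * D / eps.
have H_gt0 : 0 < H by rewrite /H divr_gt0 // mulr_gt0 // exprn_gt0.
exists (Num.bound (H ^+ r / gamma)).+1, (2 ^+ r * D); split => //.
split; first by rewrite mulr_gt0 // exprn_gt0.
move=> n n0n I intI epsL gammaL Leps t t_neq0 X XI gammaX piX.
have n_gt0 : 0 < n%:R :> R by rewrite ltr0n (leq_trans _ n0n).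
have Hn : H ^+ r < gamma * n%:R.
  rewrite mulrC -ltr_pdivrMr //.
  have Hr_ge0 : 0 <= H ^+ r / gamma by rewrite divr_ge0 ?exprn_ge0 ?ltW.
  by apply: lt_le_trans (archi_boundP Hr_ge0) _; rewrite ler_nat ltnW.
have [p pI] : exists p : 'I_r -> int,
    forall j k, (k \in I j) = (p j <= k < p j + (#|` I j|)%:Z).
  apply: (@fin_all_exists _ (fun=> int)
    (fun j pj => forall k, (k \in I j) = (pj <= k < pj + (#|` I j|)%:Z))) => j.
  exact: finite_intervalE.
pose L j := #|` I j|.
have XL : (X `<=` int_box p L)%fset.
  by apply/fsubsetP => x /XI xI; apply/in_int_box => j; rewrite -pI; apply: xI.
set N := #|` box_image t p L|.
have N_le : N%:R <= D * n%:R ^+ 2.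
  have := card_box_image_le t XL; rewrite -/N -(ler_nat R) !natrM natrX.
  rewrite natr_prod => XN.
  have nr_gt0 : 0 < n%:R ^+ r.+1 :> R by rewrite exprn_gt0.
  rewrite -(ler_pM2l (mulr_gt0 gamma_gt0 nr_gt0)).
  apply: (@le_trans _ _ (#|` X|%:R * N%:R)); first by rewrite ler_wpM2r.
  apply: le_trans XN _.
  apply: (@le_trans _ _ (C * n%:R ^+ 2 * (2 ^+ r * (eps^-1 * n%:R ^+ r.+1)))).
    apply: ler_pM => //; first by rewrite mulr_ge0 ?exprn_ge0 ?prodr_ge0.
    by rewrite ler_wpM2l ?exprn_ge0.
  by rewrite le_eqVlt; apply/orP; left; apply/eqP; rewrite /D; field; rewrite !gt_eqF.
have [j0 Lj0] := exists_long_side (ltW H_gt0) Hn gammaL.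
have bigL j : (2 ^ r.+2 * N < L j0 * L j)%N.
  rewrite -(ltr_nat R) 2!natrM natrX.
  apply: (@le_lt_trans _ _ (H * n%:R * (eps * n%:R))).
    apply: (@le_trans _ _ (2 ^+ r.+2 * (D * n%:R ^+ 2))).
      by rewrite ler_pM2l ?exprn_gt0.
    by rewrite le_eqVlt; apply/orP; left; apply/eqP; rewrite /H; field; rewrite gt_eqF.
  apply: (@lt_le_trans _ _ ((L j0)%:R * (eps * n%:R))).
    by rewrite ltr_pM2r // mulr_gt0.
  by rewrite ler_wpM2l //; apply: epsL.
pose s := rem j0 (enum 'I_r).
have us : uniq (rcons s j0).
  by rewrite rcons_uniq rem_uniq ?enum_uniq // mem_rem_uniq ?enum_uniq // !inE eqxx.
have mem_s j : j \in rcons s j0.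
  by rewrite mem_rcons inE mem_rem_uniq ?enum_uniq // !inE mem_enum andbT orbN.
have [u [a [M [a_gt0 inP kP]]]] := long_progression_in_box_image t_neq0 bigL us.
have M_le : (M <= N)%N.
  have inN (i : 'I_M) : u + a * (i : nat)%:R \in box_image t p L.
    apply: box_imageS (inP _ (ltn_ord i)) => j.
    rewrite /partial_sides; case: ifP => // _.
    by have := leq_ltn_trans (leq0n _) (bigL j); rewrite muln_gt0 => /andP[].
  rewrite -[M]card_ord /N cardfE.
  apply: (@leq_card _ _ (fun i => [` inN i]%fset)) => i i' /(congr1 val) /=.
  move=> /addrI /(mulfI (lt0r_neq0 a_gt0)) /eqP; rewrite eqr_nat => /eqP.
  exact: val_inj.
have sr : (size s <= r)%N.
  by rewrite size_rem ?mem_enum // size_enum_ord leq_pred.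
exists a; split => //; split => j; have [k [tk kM]] := kP j (mem_s j).
  by exists k.
rewrite tk mulKf ?gt_eqF // -intr_norm -natr_absz -natrM.
apply: (@le_trans _ _ ((2 ^ r * N)%:R)).
  rewrite ler_nat; apply: leq_trans kM _.
  by apply: leq_mul => //; rewrite leq_pexp2l.
by rewrite natrM natrX -mulrA ler_pM2l ?exprn_gt0.
Qed.
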